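(* For all positive integers $n\leq N$, \[ st_{\Sigma}(n,N)=\left\lceil\frac{n}{2}\right\rceil+N-1. \]
   Context: Let $M$ be a matrix with entries in $\{0,1\}$; rows are indexed from top to bottom and columns from left to right. For $c\in\{0,1\}$, a $c$-staircase in $M$ is a sequence $s_1,\dots,s_\ell$ of entries (positions) of $M$, all with value $c$, such that for each $i=1,\dots,\ell-1$ the entry $s_{i+1}$ is either strictly to the right of $s_i$ in the same row, or strictly below $s_i$ in the same column ($s_i$ and $s_{i+1}$ need not be neighbouring positions). Its length is $\ell$, the number of its elements. $st_0(M)$ (resp. $st_1(M)$) denotes the maximum length of a $0$-staircase (resp. $1$-staircase) in $M$, taken to be $0$ if $M$ has no entry equal to $0$ (resp. $1$). Put $st_{\Sigma}(M)=st_0(M)+st_1(M)$ and \[ st_{\Sigma}(n,N)=\min\{st_{\Sigma}(M): M\in\{0,1\}^{n\times N}\}, \] where $\{0,1\}^{n\times N}$ is the set of $0$-$1$ matrices with $n$ rows and $N$ columns. *)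

(* Defs.v *)
From mathcomp Require Import all_boot all_order all_algebra.

Set Implicit Arguments.
Unset Strict Implicit.
Unset Printing Implicit Defensive.

(* 0-1 matrices have type 'M[bool]_(n, N), with false for 0 and true for 1.
   A position is a pair (row, column); rows are numbered downwards and columns
   rightwards. *)

Definition stair_step (n N : nat) : rel ('I_n * 'I_N) :=
  fun p q => ((p.1 == q.1) && (p.2 < q.2)) || ((p.2 == q.2) && (p.1 < q.1)).

(* The empty sequence is allowed: it contributes the length 0, which is the
   required maximum when no entry of M equals c. *)
Definition staircase (n N : nat) (c : bool) (M : 'M[bool]_(n, N))
    (s : seq ('I_n * 'I_N)) : bool :=
  all (fun p => M p.1 p.2 == c) s && sorted (@stair_step n N) s.

Definition has_staircase (n N : nat) (c : bool) (M : 'M[bool]_(n, N)) :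
    pred nat :=
  fun l => [exists s : l.-tuple ('I_n * 'I_N), staircase c M s].

Lemma has_staircase0 (n N : nat) (c : bool) (M : 'M[bool]_(n, N)) :
  exists l, has_staircase c M l.
Proof. by exists 0; apply/existsP; exists [tuple]. Qed.

Lemma has_staircase_bound (n N : nat) (c : bool) (M : 'M[bool]_(n, N)) l :
  has_staircase c M l -> l <= n + N.
Proof.
have E u : forall r : 'I_n * 'I_N, path (@stair_step n N) r u ->
    (size u).+1 + (r.1 + r.2) <= n + N.
  elim: u => [|r' u IHu] r /=.
    by move=> _; rewrite add1n -addSn leq_add // ltnW.
  case/andP=> rr' /IHu; apply: leq_trans.
  rewrite addSnnS leq_add2l.
  by case/orP: rr' => /andP[/eqP-> lt]; rewrite ?ltn_add2l ?ltn_add2r.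
case/existsP=> s /andP[_]; have := size_tuple s.
case: (tval s) => [|p t] /= <- // /E; apply: leq_trans.
by rewrite leq_addr.
Qed.

Definition st (n N : nat) (c : bool) (M : 'M[bool]_(n, N)) : nat :=
  ex_maxn (has_staircase0 c M) (@has_staircase_bound n N c M).

Definition st_Sigma (n N : nat) (M : 'M[bool]_(n, N)) : nat :=
  st false M + st true M.

(* The zero matrix only serves as a witness that 'M[bool]_(n, N) is inhabited;
   the minimum ranges over all matrices. *)
Definition st_Sigma_min (n N : nat) : nat :=
  st_Sigma [arg min_(M < (const_mx false : 'M[bool]_(n, N))) st_Sigma M].

(* Main.v *)
Require Import Defs.
From mathcomp Require Import all_boot all_order all_algebra.
From mathcomp Require Import zify.

(** Both bounds are short.

    Lower bound.  Some colour [c] fills at least [uphalf n] cells of the first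
    column.  Walk down these cells to the last of them, in row [r], and then
    along the cells of colour [c] of row [r].  The remaining cells of row [r]
    form a staircase of the other colour.  The two staircases together cover
    row [r] and at least [uphalf n - 1] more cells of the first column, whence
    [N + uphalf n - 1] in total ([column_then_row], [st_Sigma_ge]).

    Upper bound.  The sum [i + j] of the coordinates increases strictly along
    any staircase, so a staircase confined to [b - a] consecutive antidiagonals
    has at most [b - a] cells ([size_staircase_band]).  Put the zeros on the
    [N - 1] antidiagonals from [h := uphalf n] on; the ones then form a triangle
    in the top left corner, on [h] antidiagonals, and a triangle in the bottom
    right corner, on [n - h <= h] antidiagonals.  Because [n <= N], the two
    triangles share neither a row nor a column, so that no staircase goes from
    one to the other ([band_mx], [st_Sigma_band_mx]). *)

Lemma st_ge (n N : nat) (c : bool) (M : 'M[bool]_(n, N)) s :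
  staircase c M s -> size s <= st c M.
Proof.
move=> Ms; rewrite /st; case: ex_maxnP => l _; apply.
by apply/existsP; exists (in_tuple s).
Qed.

Lemma st_le (n N : nat) (c : bool) (M : 'M[bool]_(n, N)) b :
  (forall s, staircase c M s -> size s <= b) -> st c M <= b.
Proof.
move=> Hb; rewrite /st; case: ex_maxnP => l /existsP[s Ms] _.
by rewrite -(size_tuple s); apply: Hb.
Qed.

Lemma sorted_filter_ord (n : nat) (P : pred 'I_n) :
  sorted (relpre val ltn) [seq i <- enum 'I_n | P i].
Proof.
apply: sorted_filter; first by move=> y x z; apply: ltn_trans.
by rewrite -sorted_map val_enum_ord iota_ltn_sorted.
Qed.

Lemma sorted_column (n N : nat) (j : 'I_N) (P : pred 'I_n) :
  sorted (@stair_step n N) [seq (i, j) | i <- enum 'I_n & P i].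
Proof.
rewrite sorted_map; apply: sub_sorted (sorted_filter_ord n P) => x y /= lt_xy.
by rewrite /stair_step /= eqxx lt_xy orbT.
Qed.

Lemma sorted_row (n N : nat) (i : 'I_n) (P : pred 'I_N) :
  sorted (@stair_step n N) [seq (i, j) | j <- enum 'I_N & P j].
Proof.
rewrite sorted_map; apply: sub_sorted (sorted_filter_ord N P) => x y /= lt_xy.
by rewrite /stair_step /= eqxx lt_xy.
Qed.

Lemma row_staircase (n N : nat) (c : bool) (M : 'M[bool]_(n, N)) (i : 'I_n) :
  staircase c M [seq (i, j) | j <- enum 'I_N & M i j == c].
Proof.
rewrite /staircase sorted_row andbT all_map.
exact: filter_all.
Qed.

(** The walk down the colour [c] in the first column and then along the row [r]
    of its last cell there; the cell at the corner belongs to both counts,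
    which accounts for the [- 1]. *)
Lemma column_then_row (n N : nat) (c : bool) (M : 'M[bool]_(n, N.+1)) :
  0 < count (fun i => M i ord0 == c) (enum 'I_n) ->
  exists r, count (fun i => M i ord0 == c) (enum 'I_n)
    + count (fun j => M r j == c) (enum 'I_N.+1) - 1 <= st c M.
Proof.
rewrite -!size_filter => col_gt0.
have := sorted_column n N.+1 ord0 (fun i => M i ord0 == c).
have := filter_all (fun i => M i ord0 == c) (enum 'I_n).
case/lastP: [seq _ <- _ | _] col_gt0 => // t r _.
rewrite all_rcons => /andP[Mr0 Mt] sorted_t; exists r.
have := row_staircase n N.+1 c M r; rewrite -size_filter /staircase.
rewrite enum_ordSl /= Mr0 /=; set u := filter _ _.
case/andP=> /andP[_ Mu] path_u.
have /st_ge: staircase c M ([seq (i, ord0) | i <- rcons t r]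
                              ++ [seq (r, j) | j <- u]).
  rewrite /staircase all_cat Mu andbT all_map all_rcons /= Mr0 Mt /=.
  by move: sorted_t; rewrite map_rcons; case: t {Mt} => [|x t] //=;
     rewrite cat_path last_rcons path_u andbT.
by rewrite size_cat !size_map addnS subn1.
Qed.

Lemma st_Sigma_ge (n N : nat) (M : 'M[bool]_(n, N)) :
  0 < n -> 0 < N -> uphalf n + N - 1 <= st_Sigma M.
Proof.
case: N M => [//|N] M n_gt0 _.
have [c maj] : exists c, uphalf n <= count (fun i => M i ord0 == c) (enum 'I_n).
  have := count_predC (fun i => M i ord0 == true) (enum 'I_n).
  rewrite size_enum_ord => col_total.
  have [le_t | gt_t] :=
    leqP (uphalf n) (count (fun i => M i ord0 == true) (enum 'I_n)).
    by exists true.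
  exists false; rewrite (@eq_count _ _ (predC (fun i => M i ord0 == true))).
    by lia.
  by move=> i /=; case: (M i ord0).
have [|r r_le] := column_then_row n N c M; first by lia.
have r_ge := st_ge _ _ _ _ _ (row_staircase n N.+1 (~~ c) M r).
have := count_predC (fun j => M r j == c) (enum 'I_N.+1).
rewrite size_enum_ord size_map size_filter in r_ge *.
have -> : st_Sigma M = st c M + st (~~ c) M.
  by rewrite /st_Sigma; case: (c) => //; rewrite addnC.
rewrite (@eq_count _ (predC _) (fun j => M r j == ~~ c)); first by lia.
by move=> j /=; case: (M r j); case: (c).
Qed.

(** Each step raises [i + j], so the antidiagonals met are pairwise distinct
    elements of the interval from [a] to [b - 1]. *)
Lemma size_staircase_band (n N a b : nat) (s : seq ('I_n * 'I_N)) :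
  sorted (@stair_step n N) s ->
  all (fun p : 'I_n * 'I_N => a <= p.1 + p.2 < b) s ->
  size s <= b - a.
Proof.
move=> sorted_s /allP band_s.
rewrite -(size_map (fun p : 'I_n * 'I_N => p.1 + p.2)) -(size_iota a (b - a)).
apply: uniq_leq_size => [|_ /mapP[p /band_s p_band ->]]; last first.
  by rewrite mem_iota; lia.
apply: (sorted_uniq ltn_trans ltnn); rewrite sorted_map.
apply: sub_sorted sorted_s => p q /=.
by case/orP=> /andP[/eqP-> lt_pq]; rewrite ?ltn_add2l ?ltn_add2r.
Qed.

Definition band_mx (n N : nat) : 'M[bool]_(n, N) :=
  \matrix_(i, j) ~~ (uphalf n <= i + j < uphalf n + N - 1).

(** A row meeting both triangles would have its index both below [uphalf n]
    and at least [uphalf n]; a column meeting both would have its index below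
    [uphalf n], so it would need a row of index at least [N >= n]. *)
Lemma band_mx_step (n N : nat) (p q : 'I_n * 'I_N) : n <= N ->
  band_mx n N q.1 q.2 -> stair_step p q ->
  p.1 + p.2 < uphalf n -> q.1 + q.2 < uphalf n.
Proof.
case: p q => [i j] [i' j'] le_nN; rewrite mxE /stair_step /=.
have := ltn_ord i'; have := ltn_ord j'.
by move=> ? ? ? /orP[] /andP[/eqP/(congr1 val) /= ? ?]; lia.
Qed.

Lemma band_mx_one_side (n N : nat) (p : 'I_n * 'I_N) s : n <= N ->
  all (fun q => band_mx n N q.1 q.2 == true) s -> path (@stair_step n N) p s ->
  p.1 + p.2 < uphalf n -> all (fun q : 'I_n * 'I_N => q.1 + q.2 < uphalf n) s.
Proof.
move=> le_nN; elim: s p => //= q s IHs p.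
move=> /andP[/eqP Mq Ms] /andP[pq path_s] lt_p.
have lt_q := band_mx_step n N p q le_nN Mq pq lt_p.
by rewrite lt_q (IHs q).
Qed.

Lemma stair_path_ge (n N a : nat) (p : 'I_n * 'I_N) s :
  path (@stair_step n N) p s -> a <= p.1 + p.2 ->
  all (fun q : 'I_n * 'I_N => a <= q.1 + q.2) s.
Proof.
elim: s p => //= q s IHs p /andP[pq path_s] le_p.
have le_q : a <= q.1 + q.2.
  by apply: leq_trans le_p _; case/orP: pq => /andP[/eqP-> lt]; lia.
by rewrite le_q (IHs q).
Qed.

Lemma st_false_band_mx (n N : nat) : st false (band_mx n N) <= N - 1.
Proof.
apply: st_le => s /andP[Ms sorted_s].
have -> : N - 1 = uphalf n + (N - 1) - uphalf n by lia.
apply: size_staircase_band sorted_s _; apply: sub_all Ms => p.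
by rewrite mxE eqbF_neg negbK; lia.
Qed.

Lemma st_true_band_mx (n N : nat) :
  n <= N -> st true (band_mx n N) <= uphalf n.
Proof.
move=> le_nN; apply: st_le => -[|p s] // /andP[Ms sorted_s].
have /= /andP[/eqP Mp Ms'] := Ms.
have [lt_p | ge_p] := ltnP (p.1 + p.2) (uphalf n).
  rewrite -[leqRHS]subn0; apply: size_staircase_band (sorted_s) _ => /=.
  by rewrite lt_p (band_mx_one_side n N p).
(* The last antidiagonal is [n + N - 2], and [n - uphalf n <= uphalf n]. *)
apply: (@leq_trans (n + N - 1 - (uphalf n + N - 1))); last by lia.
apply: size_staircase_band (sorted_s) _.
have ge_s : all (fun q : 'I_n * 'I_N => uphalf n + N - 1 <= q.1 + q.2) (p :: s).
  have ge_p' : uphalf n + N - 1 <= p.1 + p.2 by move: Mp; rewrite mxE; lia.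
  by rewrite /= ge_p' (stair_path_ge n N _ p).
apply: sub_all ge_s => q ->.
by have := ltn_ord q.1; have := ltn_ord q.2; lia.
Qed.

Lemma st_Sigma_band_mx (n N : nat) :
  0 < N -> n <= N -> st_Sigma (band_mx n N) <= uphalf n + N - 1.
Proof.
move=> N_gt0 le_nN; rewrite /st_Sigma.
have := st_false_band_mx n N; have := st_true_band_mx n N le_nN; lia.
Qed.

Theorem theorem5 (n N : nat) :
  0 < n -> n <= N -> st_Sigma_min n N = uphalf n + N - 1.
Proof.
move=> n_gt0 le_nN; have N_gt0 := leq_trans n_gt0 le_nN.
rewrite /st_Sigma_min; case: arg_minnP => // M _ M_min.
apply/eqP; rewrite eqn_leq st_Sigma_ge // andbT.
by apply: leq_trans (M_min _ isT) _; apply: st_Sigma_band_mx.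
Qed.
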